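(* Let $\psi=\psi^{(N)}\colon\{0,1\}^N\to\mathcal{B}_N$ ($N$ even) be the family of bijections defined in the context, and let $\psi_1$ denote its first output bit. Then the function $\mathrm{majority}$ is $\mathbf{NC}^0$-reducible to $\psi_1$, i.e., $\mathrm{majority}\le_{\mathbf{NC}^0}\psi_1$. In particular, $\psi_1\notin\mathbf{AC}^0$.
   Context: $\mathrm{majority}\colon\{0,1\}^n\to\{0,1\}$ is $1$ on $x$ iff $|x|>n/2$, where $|x|$ is the Hamming weight of $x$. $\mathrm{majority}\le_{\mathbf{NC}^0}\psi_1$ means: there are maps $r_n\colon\{0,1\}^n\to\{0,1\}^{N(n)}$ with $N(n)$ even and polynomially bounded in $n$, each output bit of $r_n$ depending on at most a constant number (independent of $n$) of input bits, such that $\mathrm{majority}(x)=\psi_1(r_n(x))$ for all $x\in\{0,1\}^n$. $\mathbf{AC}^0$ is the class of function families computed by polynomial-size, constant-depth circuits with unbounded fan-in AND, OR and NOT gates. $\circ$ denotes concatenation, and $\mathcal{B}_N=\{x\in\{0,1\}^{N+1}: |x|>N/2\}$. Marking stage. Given $x\in\{0,1\}^N$, all coordinates start unmarked. Repeatedly choose two unmarked coordinates $p<q$ with no unmarked coordinate strictly between them and with $x_p=1$, $x_q=0$, and mark both; stop when no such pair exists. The final set of marked coordinates does not depend on the choices made. When the process stops, the unmarked bits, read from left to right, form a string $0\cdots01\cdots1$. Chains. Let $i_1<\dots<i_m$ be the finally unmarked coordinates of $x$ (so $m\equiv N \pmod 2$), and let $k=(N-m)/2$. The chain containing $x$ is $\{c_k,c_{k+1},\dots,c_{N-k}\}$,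 where $c_r$ (for $k\le r\le N-k$) agrees with $x$ on all marked coordinates, equals $0$ on the $m-(r-k)$ leftmost unmarked coordinates and equals $1$ on the remaining $r-k$ unmarked coordinates. Then $|c_r|=r$. These chains (the De Bruijn–Tengbergen–Kruyswijk chains) partition $\{0,1\}^N$. The map $\psi$. For even $N$ and $x\in\{0,1\}^N$ lying in the chain $\{c_k,\dots,c_{N-k}\}$ with $x=c_j$, \[ \psi(x)=\begin{cases} c_{\frac{(N-k)+j}{2}}\circ 1, & j\equiv N-k \pmod 2,\\[2pt] c_{\frac{(N-k)+j+1}{2}}\circ 0, & j\not\equiv N-k \pmod 2.\end{cases} \] This is a bijection from $\{0,1\}^N$ to $\mathcal{B}_N$. *)

(* Defs.v *)
From mathcomp Require Import all_boot.

Set Implicit Arguments.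
Unset Strict Implicit.
Unset Printing Implicit Defensive.

Definition bits (n : nat) := n.-tuple bool.

(* A family gives one Boolean function per input length. When a family is
   meaningful only for some lengths, the notions below take the set of
   relevant lengths as an extra argument. *)
Definition boolfam := forall n : nat, bits n -> bool.

Definition even : pred nat := fun n => ~~ odd n.

Definition hweight n (x : bits n) : nat := count id x.

Definition poly_bounded (s : nat -> nat) : Prop :=
  exists c : nat, forall n : nat, s n <= n ^ c + c.

(* |x| > n/2 with rational n/2, cleared of its denominator *)
Definition majority : boolfam := fun n x => n < 2 * hweight x.

(* f depends on at most d of its input bits *)
Definition depends_on_at_most n (d : nat) (f : bits n -> bool) : Prop :=
  exists2 S : {set 'I_n}, #|S| <= d &
    forall x y : bits n,
      (forall i, i \in S -> tnth x i = tnth y i) -> f x = f y.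

Definition NC0_reducible (f : boolfam) (D : pred nat) (g : boolfam) : Prop :=
  exists (N : nat -> nat) (r : forall n, bits n -> bits (N n)) (d : nat),
    [/\ forall n, D (N n),
        poly_bounded N,
        forall n (i : 'I_(N n)), depends_on_at_most d (fun x => tnth (r n x) i)
      & forall n (x : bits n), f n x = g (N n) (r n x)].

(* Circuits are straight-line programs: on n inputs, wires 0, ..., n-1 carry
   the inputs and wire n + i carries the output of the i-th gate. *)
Inductive gate := And of seq nat | Or of seq nat | Not of nat.

Record circuit := Circuit { gates : seq gate; output : nat }.

Definition gate_inputs (g : gate) : seq nat :=
  match g with And s => s | Or s => s | Not i => [:: i] end.

Definition gate_value (w : seq bool) (g : gate) : bool :=
  match g with
  | And s => all (nth false w) s
  | Or s => has (nth false w) s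
  | Not i => ~~ nth false w i
  end.

Definition gate_depth (w : seq nat) (g : gate) : nat :=
  (\max_(i <- gate_inputs g) nth 0 w i).+1.

(* acyclicity: a gate only reads inputs and outputs of earlier gates *)
Definition circuit_wf (n : nat) (C : circuit) : Prop :=
  (forall i, i < size (gates C) ->
     all (fun j => j < n + i) (gate_inputs (nth (And [::]) (gates C) i)))
  /\ output C < n + size (gates C).

Definition circuit_eval n (C : circuit) (x : bits n) : bool :=
  nth false (foldl (fun w g => rcons w (gate_value w g)) x (gates C))
      (output C).

Definition circuit_depth (n : nat) (C : circuit) : nat :=
  nth 0 (foldl (fun w g => rcons w (gate_depth w g)) (nseq n 0) (gates C))
      (output C).

Definition circuit_size (C : circuit) : nat := size (gates C).

(* non-uniform AC^0, for the family f restricted to input lengths in D *)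
Definition in_AC0 (D : pred nat) (f : boolfam) : Prop :=
  exists (C : nat -> circuit) (d : nat),
    poly_bounded (fun n => if D n then circuit_size (C n) else 0) /\
    forall n, D n ->
      [/\ circuit_wf n (C n), circuit_depth n (C n) <= d
        & forall x : bits n, circuit_eval (C n) x = f n x].

Section Chains.

Variables (N : nat) (x : bits N).

Definition markable (M : {set 'I_N}) (pq : 'I_N * 'I_N) : bool :=
  let: (p, q) := pq in
  [&& p < q, p \notin M, q \notin M, tnth x p, ~~ tnth x q
    & [forall i : 'I_N, (p < i < q) ==> (i \in M)]].

Definition mark_step (M : {set 'I_N}) : {set 'I_N} :=
  if [pick pq | markable M pq] is Some (p, q) then [set p; q] :|: M else M.

(* Every effective step marks two new coordinates, so the process has stopped
   after N steps; its outcome does not depend on the pairs that are picked. *)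
Definition marked : {set 'I_N} := iter N mark_step set0.

Definition unmarked : {set 'I_N} := ~: marked.

Definition chain_bot : nat := (N - #|unmarked|)./2.

Definition unmarked_before (i : 'I_N) : nat := #|[set u in unmarked | u < i]|.

(* c_r, for chain_bot <= r <= N - chain_bot *)
Definition chain_elt (r : nat) : bits N :=
  [tuple if i \in marked then tnth x i
         else #|unmarked| - (r - chain_bot) <= unmarked_before i | i < N].

(* the list c_k, c_(k+1), ..., c_(N-k) with k = chain_bot *)
Definition chain : seq (bits N) :=
  [seq chain_elt r | r <- iota chain_bot (N - chain_bot - chain_bot).+1].

(* the index j such that x = c_j *)
Definition chain_index : nat := chain_bot + index x chain.

Definition psi : bits N.+1 :=
  let top := N - chain_bot in
  let j := chain_index in
  if odd j == odd top then [tuple of rcons (chain_elt (top + j)./2) true]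
  else [tuple of rcons (chain_elt (top + j + 1)./2) false].

End Chains.

Definition psi1 : boolfam := fun N x => tnth (psi x) ord0.

(* Main.v *)
(* Reduction: if x starts with 0, then that coordinate is never marked, and the
   first bit of psi(x) is 1 exactly when it is the only unmarked zero of x; by
   matching ones to later zeros this says that every prefix of x has at most one
   more zero than ones. For 0 1^n x 0^(n+1) 1^(3n) the critical prefix ends after
   the last block of zeros, and the condition becomes |x| > n/2. The final block
   only makes the length even.

   Lower bound (Razborov, Smolensky): over F_2, a circuit of depth d and size s
   agrees with a polynomial of degree O(t^d) outside a fraction s / 2^t of the
   cube. If P of degree D agrees with majority on G, then every function on G has
   degree at most n/2 + D, so |G| is at most the number of sets of size at most
   n/2 + D, which is 2^(n-1) + O(D 2^n / sqrt n). *)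
Require Import Defs.
From mathcomp Require Import all_boot zify.

Set Implicit Arguments.
Unset Strict Implicit.
Unset Printing Implicit Defensive.

(** * Polynomials over F_2 *)

(* A polynomial is a list of monomials, each given by its set of variables; a
   point of the cube is given by its support. *)
Definition lowdeg n k (f : {set 'I_n} -> bool) : Prop :=
  exists2 s : seq {set 'I_n}, all (fun S : {set 'I_n} => #|S| <= k) s
    & forall A, f A = \big[addb/false]_(S <- s) (S \subset A).

Section LowDegree.

Variable n : nat.
Implicit Types (f g : {set 'I_n} -> bool) (A S : {set 'I_n}).

Lemma lowdeg_ext k f g : f =1 g -> lowdeg k f -> lowdeg k g.
Proof. by move=> eq_fg [s ks fs]; exists s => // A; rewrite -eq_fg. Qed.

Lemma lowdegW k l f : k <= l -> lowdeg k f -> lowdeg l f.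
Proof.
move=> le_kl [s ks fs]; exists s => //.
by apply: sub_all ks => S; move/leq_trans; apply.
Qed.

Lemma lowdeg_const k (b : bool) : lowdeg k (fun _ : {set 'I_n} => b).
Proof.
exists (nseq b set0); first by case: b; rewrite //= cards0.
by case: b => A; rewrite /= ?big_nil // big_seq1 sub0set.
Qed.

Lemma lowdeg_mono S : lowdeg #|S| (fun A => S \subset A).
Proof. by exists [:: S] => [|A]; rewrite ?big_seq1 //= leqnn. Qed.

Lemma lowdeg_addb k f g :
  lowdeg k f -> lowdeg k g -> lowdeg k (fun A => f A (+) g A).
Proof.
move=> [s ks fs] [t kt gt]; exists (s ++ t); first by rewrite all_cat ks.
by move=> A; rewrite big_cat fs gt.
Qed.

Lemma lowdeg_negb k f : lowdeg k f -> lowdeg k (fun A => ~~ f A).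
Proof. by move=> df; apply: (lowdeg_addb (lowdeg_const k true) df). Qed.

Lemma lowdeg_andb k l f g :
  lowdeg k f -> lowdeg l g -> lowdeg (k + l) (fun A => f A && g A).
Proof.
move=> [s ks fs] [t lt gt]; exists [seq U :|: V | U <- s, V <- t].
  apply/allP=> _ /allpairsP[[S T] /= [sS tT ->]].
  rewrite (leq_trans (leq_card_setU _ _)) // leq_add //.
    exact: (allP ks).
  exact: (allP lt).
move=> A; rewrite big_allpairs_dep fs gt big_distrlr /=.
by apply: eq_bigr => S _; apply: eq_bigr => T _; rewrite subUset.
Qed.

Lemma lowdeg_sum k (I : eqType) (r : seq I) (F : I -> {set 'I_n} -> bool) :
    (forall i, i \in r -> lowdeg k (F i)) ->
  lowdeg k (fun A => \big[addb/false]_(i <- r) F i A).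
Proof.
elim: r => [|i r IHr] dF.
  by apply: lowdeg_ext (lowdeg_const k false) => A; rewrite big_nil.
have di := dF i (mem_head i r).
have dr := IHr (fun j rj => dF j (mem_behead (rj : j \in behead (i :: r)))).
by apply: lowdeg_ext (lowdeg_addb di dr) => A; rewrite big_cons.
Qed.

(** Shannon expansion at a variable [i] of [S]: over F_2, [f = f0 + x_i (f0 + f1)], where [f0] and
    [f1] no longer depend on [i]. *)
Lemma lowdeg_junta S f : (forall A, f A = f (A :&: S)) -> lowdeg #|S| f.
Proof.
have [m] := ubnP #|S|; elim: m S f => // m IHm S f ltSm fS.
have [S0|[i iS]] := set_0Vmem S.
  by apply: lowdeg_ext (lowdeg_const #|S| (f set0)) => A; rewrite [RHS]fS S0 setI0.
have cardS : #|S| = #|S :\ i|.+1 by rewrite (cardsD1 i) iS.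
pose f0 A := f (A :\ i); pose f1 A := f (i |: A).
have d0 : lowdeg #|S :\ i| f0.
  apply: IHm => [|A]; first by rewrite -cardS.
  rewrite /f0 [LHS]fS [RHS]fS; congr f; apply/setP=> j; rewrite !inE.
  by case: eqP => //= _; rewrite -andbA andbb.
have d1 : lowdeg #|S :\ i| f1.
  apply: IHm => [|A]; first by rewrite -cardS.
  rewrite /f1 [LHS]fS [RHS]fS; congr f; apply/setP=> j; rewrite !inE.
  by case: eqP => //= _; rewrite -andbA andbb.
have di : lowdeg 1 (fun A => i \in A).
  by have := lowdeg_mono [set i]; rewrite cards1;
    apply: lowdeg_ext => A; rewrite sub1set.
rewrite cardS -add1n.
apply: lowdeg_ext
  (lowdeg_addb (lowdegW (leqnSn _) d0) (lowdeg_andb di (lowdeg_addb d0 d1))) => A.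
have [iA|niA] /= := boolP (i \in A).
  by rewrite addKb /f1 (setUidPr _) ?sub1set.
rewrite addbF /f0; congr f; apply/setP=> j; rewrite !inE.
by case: eqP => // ->; rewrite (negPf niA).
Qed.

Lemma lowdeg_setC k f : lowdeg k f -> lowdeg k (fun A => f (~: A)).
Proof.
case=> s /allP ks fs; apply: lowdeg_ext (fun A => esym (fs _)) _.
apply: lowdeg_sum => S /ks; move/lowdegW; apply.
apply: lowdeg_junta => A; rewrite !subsets_disjoint !setCK.
by rewrite -!setI_eq0 setIA [S :&: A]setIC -setIA setIid setIC.
Qed.

(** The interpolant is corrected level by level: at a set [A] of size [k.+1] the only monomial of
    degree [k.+1] that does not vanish is that of [A], and on smaller sets they all vanish. *)
Lemma lowdeg_interpolate k f :
  exists2 g, lowdeg k g & forall A, #|A| <= k -> g A = f A.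
Proof.
elim: k => [|k [g dg gf]].
  exists (fun=> f set0); first exact: lowdeg_const.
  by move=> A; rewrite leqn0 cards_eq0 => /eqP->.
pose s := enum [set S : {set 'I_n} | (#|S| == k.+1) && (f S != g S)].
exists (fun A => g A (+) \big[addb/false]_(S <- s) (S \subset A)).
  apply: lowdeg_addb (lowdegW (leqnSn k) dg) _; apply: lowdeg_sum => S.
  by rewrite mem_enum inE => /andP[/eqP<- _]; apply: lowdeg_mono.
move=> A; rewrite big_enum big_mkcond /= leq_eqVlt => /orP[/eqP cA|leA].
  rewrite (bigD1 A) //= big1 => [|S /negPf neSA].
    by rewrite inE cA eqxx subxx; case: (f A); case: (g A).
  case: ifP => //; rewrite inE => /andP[/eqP cS _].
  apply/negP => sSA; move: neSA.
  by rewrite eqEcard sSA cS cA leqnn.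
rewrite -gf // big1 ?addbF // => S _; case: ifP => //.
rewrite inE => /andP[/eqP cS _]; apply/negP => /subset_leq_card.
by rewrite cS leqNgt leA.
Qed.

(** Equal monomials cancel in pairs, so polynomials can be counted as sets of monomials. *)
Lemma sum_addb_odd_count (s : seq {set 'I_n}) A :
  \big[addb/false]_(S <- s) (S \subset A)
    = \big[addb/false]_(S in [set S | odd (count_mem S s)]) (S \subset A).
Proof.
rewrite [RHS]big_mkcond /=; elim: s => [|T s IHs].
  by rewrite big_nil big1 // => S _; rewrite inE.
rewrite big_cons IHs [RHS](eq_bigr (fun S => (if S == T then S \subset A else false)
   (+) (if S \in [set S | odd (count_mem S s)] then S \subset A else false))).
  by rewrite big_split -!big_mkcond big_pred1_eq.
move=> S _; rewrite !inE /= oddD oddb eq_sym.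
by case: (S == T); case: (odd _); case: (S \subset A).
Qed.

(** Evaluation on [G] maps the sets of monomials of degree at most [k] onto the subsets of [G];
    compare the two powersets. *)
Lemma lowdeg_separated_card k (G : {set {set 'I_n}}) :
    (forall f, exists2 g, lowdeg k g & {in G, f =1 g}) ->
  #|G| <= #|[set S : {set 'I_n} | #|S| <= k]|.
Proof.
move=> Gk; set L := [set S : {set 'I_n} | _].
pose ev (F : {set {set 'I_n}}) :=
  [set A in G | \big[addb/false]_(S in F) (S \subset A)].
rewrite -(@leq_exp2l 2) // -!card_powerset.
apply: leq_trans (leq_imset_card ev (mem (powerset L))).
apply/subset_leq_card/subsetP => H; rewrite powersetE => sHG.
have [g [s ks gs] Hg] := Gk (fun A => A \in H).
apply/imsetP; exists [set S | odd (count_mem S s)].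
  rewrite powersetE; apply/subsetP=> S; rewrite !inE => odd_s.
  apply: (allP ks); rewrite -has_pred1 has_count.
  by case: (count _ _) odd_s.
apply/setP=> A; rewrite inE -sum_addb_odd_count -gs.
by case: (boolP (A \in G)) => [/Hg //|]; apply: contraNF; apply: (subsetP sHG).
Qed.

End LowDegree.

(** * Razborov's approximation of circuits *)

Section ParityApproximation.

Variables (T : finType) (I : eqType) (F : I -> T -> bool).

Local Notation parity r x := (\big[addb/false]_(i <- r) F i x).

(* The offset h makes the induction on r go through: the points where F i is
   the only true function are split by the decision whether to keep i. *)
Lemma half_parity (r : seq I) (h : T -> bool) (B : {set T}) :
    {in B, forall x, has (F^~ x) r} ->
  exists2 r' : seq I, {subset r' <= r}
    & #|B| <= 2 * #|[set x in B | h x (+) parity r' x]|.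
Proof.
elim: r => [|i r IHr] in h B * => hasB.
  exists [::] => //; rewrite [B](_ : _ = set0) ?cards0 //.
  by apply/setP=> x; rewrite inE; apply/negP => /hasB.
pose B1 := [set x in B | has (F^~ x) r]; pose B0 := B :\: B1.
(* On [B0] only [F i] is true, so the parity over the new list will be [b]; take the value for which
   [h x (+) b] holds on at least half of [B0]. *)
have [b leB0] : exists b, #|B0| <= 2 * #|[set x in B0 | h x (+) b]|.
  have := cardsID [set x | h x] B0.
  rewrite (_ : B0 :\: _ = [set x in B0 | h x (+) true]); last first.
    by apply/setP=> x; rewrite !inE addbT andbC.
  rewrite (_ : B0 :&: _ = [set x in B0 | h x (+) false]); last first.
    by apply/setP=> x; rewrite !inE addbF.
  set c0 := #|[set x in B0 | h x (+) false]|; set c1 := #|[set x in B0 | h x (+) true]|.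
  move=> eB; have [le_c|lt_c] := leqP c1 c0.
    by exists false; rewrite -/c0; lia.
  by exists true; rewrite -/c1; lia.
have [x|r' r'r leB1] := IHr (fun x => h x (+) (b && F i x)) B1.
  by rewrite inE => /andP[].
exists (if b then i :: r' else r').
  move=> j; rewrite inE; case: b {leB0 leB1} => [|/r'r->]; last exact: orbT.
  by rewrite inE => /predU1P[->|/r'r->]; rewrite ?eqxx ?orbT.
set r1 := if b then _ else _.
have sum_r1 x : parity r1 x = (b && F i x) (+) parity r' x.
  by rewrite /r1; case: b {leB0 leB1 r1}; rewrite ?big_cons.
rewrite -(cardsID B1 B) -(cardsID B1 [set x in B | _]) mulnDr.
apply: leq_add.
  rewrite (_ : B :&: B1 = B1); last first.
    by apply/setIidPr/subsetP=> x; rewrite inE => /andP[].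
  apply: (leq_trans leB1); rewrite leq_mul2l; apply/subset_leq_card/subsetP => x.
  rewrite !inE sum_r1 addbA => /andP[/andP[-> ->]].
  by move->.
apply: (leq_trans leB0); rewrite leq_mul2l; apply/subset_leq_card/subsetP => x.
rewrite !inE negb_and => /andP[/andP[]]; case: (boolP (x \in B)) => //= xB nr hb.
rewrite sum_r1 nr /=.
have := hasB x xB; rewrite /= (negPf nr) orbF => ->; rewrite andbT.
rewrite big_seq big1 ?addbF // => j /r'r rj.
by apply: contraNF nr => Fj; apply/hasP; exists j.
Qed.

(** A greedy choice replaces Razborov's random sublists: each use of [half_parity] at least halves
    the set of points where all parities so far vanish. *)
Lemma exponential_parity_cover t (r : seq I) (B : {set T}) :
    {in B, forall x, has (F^~ x) r} ->
  exists2 rs : seq (seq I),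
      size rs = t /\ (forall r', r' \in rs -> {subset r' <= r})
    & #|[set x in B | all (fun r' => ~~ parity r' x) rs]| * 2 ^ t <= #|B|.
Proof.
elim: t => [|t IHt] in B * => hasB.
  exists [::] => //; rewrite muln1; apply/subset_leq_card/subsetP => x.
  by rewrite inE => /andP[].
have [r0 r0r leB] := half_parity (fun=> false) hasB.
pose B' := [set x in B | ~~ parity r0 x].
have [x|rs [sz_rs rsr] leB'] := IHt B'; first by rewrite inE => /andP[/hasB].
exists (r0 :: rs).
  by split=> [|r']; rewrite /= ?sz_rs // inE => /predU1P[->|/rsr].
rewrite (_ : [set x in B | _]
  = [set x in B' | all (fun r' => ~~ parity r' x) rs]); last first.
  by apply/setP=> x; rewrite !inE /= andbA.
have := cardsID [set x | parity r0 x] B.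
rewrite (_ : B :\: _ = B'); last by apply/setP=> x; rewrite !inE andbC.
rewrite (_ : B :&: _ = [set x in B | parity r0 x]); last first.
  by apply/setP=> x; rewrite !inE.
rewrite expnS; move: leB leB'; move: #|_| (2 ^ t) #|B'| #|B| #|_| => *; nia.
Qed.

End ParityApproximation.

Lemma lowdeg_all n k (I : eqType) (r : seq I) (F : I -> {set 'I_n} -> bool) :
    (forall i, i \in r -> lowdeg k (F i)) ->
  lowdeg (size r * k) (fun A => all (F^~ A) r).
Proof.
elim: r => [|i r IHr] dF; first exact: lowdeg_const.
rewrite /= mulSn; apply: lowdeg_andb; first exact/dF/mem_head.
by apply: IHr => j rj; apply: dF; rewrite inE rj orbT.
Qed.

(** A parity over a sublist of [r] is 0 where no [F i] holds, so the disjunction of [t] parities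
    errs only where the OR is true. *)
Lemma lowdeg_or_approx n k t (I : eqType) (F : I -> {set 'I_n} -> bool) (r : seq I) :
    (forall i, i \in r -> lowdeg k (F i)) ->
  exists g (E : {set {set 'I_n}}),
    [/\ lowdeg (t * k) g, #|E| * 2 ^ t <= 2 ^ n
      & forall A, A \notin E -> g A = has (F^~ A) r].
Proof.
move=> dF; pose B := [set A | has (F^~ A) r].
have [A|rs [<- rsr] leB] := @exponential_parity_cover _ _ F t r B; first by rewrite inE.
set E := [set A in B | _] in leB *.
exists (fun A => ~~ all (fun r' => ~~ \big[addb/false]_(i <- r') F i A) rs), E; split.
- apply: lowdeg_negb; apply: lowdeg_all => r' rs_r'.
  by apply: lowdeg_negb; apply: lowdeg_sum => i r'i; apply: dF; apply: rsr r'i.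
- rewrite (leq_trans leB) // (leq_trans (max_card _)) //.
  by rewrite -cardsT -powersetT card_powerset cardsT card_ord.
- move=> A; rewrite !inE; case: (boolP (has _ r)) => //= /hasPn nF _.
  apply/negbF/allP => r' /rsr r'r; rewrite big_seq big1 // => i /r'r /nF.
  by move/negbTE.
Qed.

Section CircuitApproximation.

Variables (n dd t : nat).
Hypothesis t_gt0 : 0 < t.

(** AND reduces to OR by De Morgan. [E] is chosen before the wire values [w], so it records only the
    error added by this gate, not the errors inherited from its inputs. *)
Lemma gate_approx (ds : seq nat) (F : nat -> {set 'I_n} -> bool) (gt : gate) :
    (forall j, lowdeg (dd * t ^ nth 0 ds j) (F j)) ->
  exists g (E : {set {set 'I_n}}),
    [/\ lowdeg (dd * t ^ gate_depth ds gt) g, #|E| * 2 ^ t <= 2 ^ n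
      & forall A w, A \notin E -> (forall j, F j A = nth false w j) ->
          g A = gate_value w gt].
Proof.
move=> dF; set h := \max_(j <- gate_inputs gt) nth 0 ds j.
have dF' j : j \in gate_inputs gt -> lowdeg (dd * t ^ h) (F j).
  move=> gt_j; apply: lowdegW (dF j); rewrite leq_mul2l leq_pexp2l ?orbT //.
  exact: leq_bigmax_seq.
have -> : dd * t ^ gate_depth ds gt = t * (dd * t ^ h).
  by rewrite /gate_depth expnS mulnCA.
case: gt @h dF' => [s|s|i] h dF' /=.
- have [j sj|g [E [dg leE gE]]] :=
      @lowdeg_or_approx n (dd * t ^ h) t _ (fun j A => ~~ F j A) s.
    exact/lowdeg_negb/dF'.
  exists (fun A => ~~ g A), E; split=> // [|A w /gE-> Fw]; first exact: lowdeg_negb.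
  by rewrite -all_predC; apply: eq_all => j /=; rewrite negbK Fw.
- have [g [E [dg leE gE]]] := @lowdeg_or_approx n (dd * t ^ h) t _ F s dF'.
  exists g, E; split=> // A w /gE-> Fw.
  by apply: eq_has => j /=; rewrite Fw.
- exists (fun A => ~~ F i A), set0; split=> [||A w _ -> //].
    apply: lowdeg_negb; apply: lowdegW (dF' i (mem_head _ _)).
    by rewrite leq_pmull.
  by rewrite cards0.
Qed.

Lemma nth_rcons_update (T : Type) (x0 : T) s x j :
  nth x0 (rcons s x) j = if j == size s then x else nth x0 s j.
Proof.
by rewrite nth_rcons; case: ltngtP => // lt_sj; rewrite nth_default // ltnW.
Qed.

(** Union bound: each gate adds at most [2 ^ n / 2 ^ t] bad points. [F] is total on wire numbers;
    past the last wire the defaults are depth 0 and value [false]. *)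
Lemma gates_approx (gs : seq gate) (w : {set 'I_n} -> seq bool) (ds : seq nat)
    (F : nat -> {set 'I_n} -> bool) (E : {set {set 'I_n}}) m :
    (forall A, size (w A) = size ds) ->
    (forall j, lowdeg (dd * t ^ nth 0 ds j) (F j)) ->
    #|E| * 2 ^ t <= m * 2 ^ n ->
    (forall A j, A \notin E -> F j A = nth false (w A) j) ->
  exists (F' : nat -> {set 'I_n} -> bool) (E' : {set {set 'I_n}}),
    let ds' := foldl (fun w g => rcons w (gate_depth w g)) ds gs in
    let w' A := foldl (fun w g => rcons w (gate_value w g)) (w A) gs in
    [/\ forall j, lowdeg (dd * t ^ nth 0 ds' j) (F' j),
        #|E'| * 2 ^ t <= (m + size gs) * 2 ^ n
      & forall A j, A \notin E' -> F' j A = nth false (w' A) j].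
Proof.
elim: gs => [|gt gs IHgs] in w ds F E m * => sz_w dF leE FE.
  by exists F, E; rewrite addn0.
have [g [E1 [dg leE1 gE1]]] := gate_approx gt dF.
rewrite /= addnS -addSn.
apply: (IHgs (fun A => rcons (w A) (gate_value (w A) gt)) _
  (fun j => if j == size ds then g else F j) (E :|: E1)).
- by move=> A; rewrite !size_rcons sz_w.
- by move=> j; rewrite nth_rcons_update; case: eqP.
- apply: leq_trans (leq_mul (leq_card_setU E E1) (leqnn _)) _.
  by rewrite mulnDl mulSn addnC leq_add.
- move=> A j; rewrite inE negb_or => /andP[nE nE1].
  rewrite nth_rcons_update sz_w; case: eqP => [_|_]; last exact: FE.
  by apply: gE1 => // i; apply: FE.
Qed.

(** Allowing inputs of degree [dd] absorbs the reduction into the bottom of the circuit. *)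
Lemma circuit_approx N (v : {set 'I_n} -> bits N) (C : circuit) :
    (forall i, lowdeg dd (fun A => tnth (v A) i)) ->
  exists g (E : {set {set 'I_n}}),
    [/\ lowdeg (dd * t ^ circuit_depth N C) g,
        #|E| * 2 ^ t <= circuit_size C * 2 ^ n
      & forall A, A \notin E -> g A = circuit_eval C (v A)].
Proof.
move=> dv.
have [||||F [E [dF leE FE]]] := @gates_approx (gates C) v (nseq N 0)
    (fun j A => nth false (v A) j) set0 0.
- by move=> A; rewrite size_tuple size_nseq.
- move=> j; rewrite nth_nseq if_same muln1.
  have [lt_jN|le_Nj] := ltnP j N.
    apply: lowdeg_ext (dv (Ordinal lt_jN)) => A.
    by rewrite (tnth_nth false).
  by apply: lowdeg_ext (@lowdeg_const n dd false) => A; rewrite nth_default ?size_tuple.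
- by rewrite cards0.
- by [].
exists (F (output C)), E; split=> // [|A /(FE _ (output C)) //].
exact: dF.
Qed.

End CircuitApproximation.

(** * The lower bound for majority *)

(** Squared form of the bound [2 * 4 ^ k / sqrt (2k + 3)]. The induction step comes down to
    [(2k + 3)(2k + 5) <= 4 (k + 2)^2]. *)
Lemma central_bin_bound k : 'C(k.*2.+1, k) ^ 2 * (k.*2 + 3) <= 4 * 16 ^ k.
Proof.
elim: k => // k IHk; rewrite doubleS.
have e1 : k.+2 * 'C(k.*2.+3, k.+1) = 2 * (k.*2 + 3) * 'C(k.*2.+1, k).
  have /= := mul_bin_diag k.*2.+3 k; have /= := mul_bin_down k.*2.+2 k.
  rewrite (_ : k.*2.+2 - k = k.+2); last by lia.
  move: 'C(k.*2.+1, k) 'C(k.*2.+2, k) 'C(k.*2.+3, k.+1) => a b c eb ec.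
  apply/eqP; rewrite -(@eqn_pmul2l k.+1) // mulnCA -ec mulnCA -eb; apply/eqP; lia.
move: e1 IHk; rewrite (expnS 16 k).
move: 'C(k.*2.+3, k.+1) 'C(k.*2.+1, k) (16 ^ k) => c' c q e1 IHk.
suff : k.+2 ^ 2 * (c' ^ 2 * (k.*2.+2 + 3)) <= k.+2 ^ 2 * (4 * (16 * q)).
  by rewrite leq_pmul2l.
rewrite mulnA -expnMn e1.
have -> : (2 * (k.*2 + 3) * c) ^ 2 * (k.*2.+2 + 3)
    = 4 * (k.*2 + 3) * (k.*2 + 5) * (c ^ 2 * (k.*2 + 3)) by lia.
apply: leq_trans (leq_mul (leqnn _) IHk) _.
have -> : k.+2 ^ 2 * (4 * (16 * q)) = (16 * k.+2 ^ 2) * (4 * q) by lia.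
by rewrite leq_mul2r; apply/orP; right; nia.
Qed.

Lemma exp2_double_succ k : 2 ^ k.*2.+1 = 2 * 4 ^ k.
Proof. by rewrite expnS -mul2n expnM. Qed.

Lemma card_half_ball k : #|[set A : {set 'I_k.*2.+1} | #|A| <= k]| = 4 ^ k.
Proof.
set L := [set A | _].
have cardLC : #|~: L| = #|L|.
  rewrite -(card_imset (mem (~: L)) (@setC_inj _)); apply: eq_card => A.
  apply/imsetP/idP => [[B] | LA].
    by rewrite !inE -ltnNge => ltkB ->; have := cardsC B; rewrite card_ord; lia.
  exists (~: A); rewrite ?setCK // !inE -ltnNge in LA *.
  by have := cardsC A; rewrite card_ord; lia.
have := cardsC L; rewrite cardLC -cardsT -powersetT card_powerset cardsT card_ord.
by rewrite exp2_double_succ; lia.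
Qed.

Lemma card_ball k D :
  #|[set A : {set 'I_k.*2.+1} | #|A| <= k + D]| <= 4 ^ k + D * 'C(k.*2.+1, k).
Proof.
have bin_le i : 'C(k.*2.+1, k + i) <= 'C(k.*2.+1, k).
  elim: i => [|i IHi]; first by rewrite addn0.
  apply: leq_trans IHi; rewrite addnS -(@leq_pmul2l (k + i).+1) // mul_bin_left.
  by rewrite leq_mul2r; apply/orP; right; lia.
elim: D => [|D IHD]; first by rewrite addn0 card_half_ball addn0.
rewrite mulSn addnCA; apply: leq_trans (leq_add (bin_le D.+1) IHD).
have := card_draws 'I_k.*2.+1 (k + D.+1); rewrite card_ord => <-.
apply: leq_trans (leq_card_setU _ _); apply/subset_leq_card/subsetP => A.
by rewrite !inE; lia.
Qed.

(* Any f agrees with g + (g + g') Maj, where g and g' have degree at most k and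
   interpolate f on the lower and on the upper half of the cube. *)
Lemma majority_approx_error k D (P : {set 'I_k.*2.+1} -> bool)
    (E : {set {set 'I_k.*2.+1}}) :
    lowdeg D P -> (forall A, A \notin E -> P A = (k < #|A|)) ->
  4 ^ k <= #|E| + D * 'C(k.*2.+1, k).
Proof.
move=> dP PE.
suff : #|~: E| <= 4 ^ k + D * 'C(k.*2.+1, k).
  have := cardsC E; rewrite -cardsT -powersetT card_powerset cardsT card_ord.
  by rewrite exp2_double_succ; lia.
apply: leq_trans (card_ball k D); apply: lowdeg_separated_card => f.
have [g dg gf] := lowdeg_interpolate k f.
(* The ground set has odd size, so complementation carries the upper half onto the lower half, where
   interpolation applies. *)
have [g1 dg1 g1f] := lowdeg_interpolate k (fun A => f (~: A)).
pose g' A := g1 (~: A).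
have dg' : lowdeg k g' := lowdeg_setC dg1.
exists (fun A => g A (+) ((g A (+) g' A) && P A)).
  apply: lowdeg_addb; first exact: lowdegW (leq_addr _ _) dg.
  exact: lowdeg_andb (lowdeg_addb dg dg') dP.
move=> A; rewrite inE => /PE->; case: leqP => [/gf->|ltkA].
  by rewrite andbF addbF.
rewrite andbT addKb /g' g1f ?setCK //.
by have := cardsC A; rewrite card_ord; lia.
Qed.

(** * Choice of parameters and the separation from AC^0 *)

Lemma exp2_dominates K e : exists2 t, 0 < t & K * t ^ e <= 2 ^ t.
Proof.
(* For this power of two the claim follows from [K + 2 v e <= (2 ^ v) ^ 2], which holds since
   [v < 2 ^ v]. *)
pose v := K + 2 * e; exists (2 ^ (2 * v)); rewrite ?expn_gt0 //.
have leK : K <= 2 ^ K by apply/ltnW/ltn_expl.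
apply: leq_trans (leq_mul leK (leqnn _)) _.
rewrite -expnM -expnD leq_exp2l // [2 * v]mulnC expnM.
have : v < 2 ^ v by apply: ltn_expl.
by rewrite /v; move: (2 ^ _) => q *; nia.
Qed.

(** A bound [K * t ^ e] absorbs constant factors, and [t > 0] lets it absorb additive constants
    too. *)
Definition poly_growth (f : nat -> nat) :=
  exists K e, forall t, 0 < t -> f t <= K * t ^ e.

Lemma poly_growth_comp (s f : nat -> nat) :
  poly_bounded s -> poly_growth f -> poly_growth (s \o f).
Proof.
case=> c sc [K [e fK]]; exists (K ^ c + c), (e * c) => t t_gt0 /=.
apply: (leq_trans (sc _)); rewrite mulnDl leq_add //.
  by rewrite expnM -expnMn; case: c {sc} => // c; rewrite leq_exp2r // fK.
by rewrite leq_pmulr // expn_gt0 t_gt0.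
Qed.

Definition bits_of_set n (A : {set 'I_n}) : bits n := [tuple i \in A | i < n].

Lemma hweight_bits_of_set n (A : {set 'I_n}) : hweight (bits_of_set A) = #|A|.
Proof.
rewrite /hweight -sum1_count big_tuple -sum1_card.
by apply: eq_bigl => i; rewrite tnth_mktuple.
Qed.

Lemma lowdeg_of_depends n d (f : bits n -> bool) :
  depends_on_at_most d f -> lowdeg d (fun A => f (bits_of_set A)).
Proof.
case=> S leS fS; apply: lowdegW leS _; apply: lowdeg_junta => A; apply: fS => i Si.
by rewrite !tnth_mktuple inE Si andbT.
Qed.

(* On n = 2k + 1 inputs with k = 8 D^2, a circuit for g yields an approximation
   of majority of degree D = dd t^d which is wrong on at most a quarter of the
   cube as soon as the size is at most 2^t / 4. *)
Lemma majority_reducible_notin_AC0 (D : pred nat) (g : boolfam) :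
  NC0_reducible majority D g -> ~ in_AC0 D g.
Proof.
case=> N [r [dd [DN polyN rdd majr]]] [C [d [polyC Cg]]].
pose deg t := dd * t ^ d; pose k t := 8 * deg t ^ 2; pose n t := (k t).*2.+1.
have n_poly : poly_growth n.
  exists (16 * dd ^ 2 + 1), (d * 2) => t t_gt0.
  rewrite /n /k /deg expnMn -expnM mulnDl mul1n.
  have : 0 < t ^ (d * 2) by rewrite expn_gt0 t_gt0.
  by rewrite -mul2n; lia.
have [K [e sizeK]] := poly_growth_comp polyC (poly_growth_comp polyN n_poly).
have [t t_gt0 leKt] := exp2_dominates (4 * K) e.
move: sizeK => /(_ t t_gt0); rewrite /= DN => sizeK.
have [wfC depthC evalC] := Cg _ (DN (n t)).
have dr i : lowdeg dd (fun A => tnth (r (n t) (bits_of_set A)) i).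
  exact: (lowdeg_of_depends (rdd _ i)).
have [P [E [dP leE PE]]] := circuit_approx t_gt0 (C (N (n t))) dr.
have dP' : lowdeg (deg t) P.
  by apply: lowdegW dP; rewrite leq_mul2l leq_pexp2l ?orbT.
have PE' A : A \notin E -> P A = (k t < #|A|).
  move=> /PE->; rewrite evalC -majr /majority hweight_bits_of_set /n; lia.
have := majority_approx_error dP' PE'; have := central_bin_bound (k t).
have leE4 : 2 * #|E| <= 4 ^ k t.
  have : 4 * #|E| * 2 ^ t <= 2 ^ n t * 2 ^ t.
    rewrite -mulnA; apply: leq_trans (leq_mul (leqnn 4) leE) _.
    rewrite mulnA mulnC leq_mul2l; apply/orP; right.
    by apply: leq_trans leKt; rewrite -mulnA leq_mul2l.
  by rewrite leq_pmul2r ?expn_gt0 // /n exp2_double_succ; lia.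
have -> : 16 ^ k t = (4 ^ k t) ^ 2 by rewrite -expnM mulnC expnM.
have : 0 < 4 ^ k t by rewrite expn_gt0.
move: leE4; rewrite /n; move: #|E| 'C(_, _) (4 ^ k t) => b c q.
(* The error bound gives [q <= 2 m c], hence [4 q^2 <= 16 m^2 c^2], while the binomial bound reads
   [(16 m^2 + 3) c^2 <= 4 q^2]; so [c = 0] and [q = 0], a contradiction. *)
by rewrite /k; move: (deg t) => m leb q_gt0 cq qb; have := leq_sqr q (2 * m * c); nia.
Qed.

(** * The reduction from majority *)

Section Marking.

Variables (N : nat) (x : bits N).
Implicit Types (M : {set 'I_N}) (b : bool) (u : nat).

Definition prefix_count M b u := #|[set i in M | (i < u) && (tnth x i == b)]|.

Lemma prefix_countU1 (i : 'I_N) M b u : i \notin M ->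
  prefix_count (i |: M) b u = ((i < u) && (tnth x i == b)) + prefix_count M b u.
Proof.
move=> niM; rewrite /prefix_count (cardsD1 i) !inE eqxx /=; congr (_ + _).
apply: eq_card => j; rewrite !inE; case: eqP => [->|] //=.
by rewrite (negPf niM).
Qed.

Lemma prefix_countC M b u :
  prefix_count M b u + prefix_count (~: M) b u = prefix_count setT b u.
Proof.
rewrite /prefix_count -[RHS](cardsID M); congr (_ + _); apply: eq_card => i.
  by rewrite !inE /= andbC.
by rewrite !inE.
Qed.

Lemma prefix_count_setT b u : prefix_count setT b u = count (pred1 b) (take u x).
Proof.
elim: u => [|u IHu].
  rewrite take0 /prefix_count (_ : [set _ in _ | _] = set0) ?cards0 //.
  by apply/setP=> i; rewrite !inE.
have [ltuN|leNu] := ltnP u N; last first.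
  have -> : take u.+1 x = take u x by rewrite !take_oversize ?size_tuple ?leqW.
  rewrite -IHu; apply: eq_card => i; rewrite !inE.
  by rewrite !(leq_trans (ltn_ord i)) // leqW.
rewrite (take_nth false) ?size_tuple // -cats1 count_cat -IHu /= addn0 addnC.
rewrite /prefix_count (cardsD1 (Ordinal ltuN)) !inE /= ltnSn (tnth_nth false) /=.
congr (_ + _); apply: eq_card => i; rewrite !inE -val_eqE /=.
by rewrite ltnS; case: ltngtP.
Qed.

(* Inside M, zeros are matched to earlier ones, and no matched pair straddles a
   coordinate outside M. *)
Definition balanced M : Prop :=
  [/\ ~~ odd #|M|, forall u, prefix_count M false u <= prefix_count M true u
    & forall i, i \notin M -> prefix_count M false i = prefix_count M true i].

Variant mark_step_spec M : {set 'I_N} -> Prop :=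
  | MarkStepPair p q of markable x M (p, q) : mark_step_spec M ([set p; q] :|: M)
  | MarkStepNone of (forall pq, ~~ markable x M pq) : mark_step_spec M M.

Lemma mark_stepP M : mark_step_spec M (mark_step x M).
Proof.
rewrite /mark_step; case: pickP => [[p q] pq|none]; first exact: MarkStepPair.
by apply: MarkStepNone => pq; rewrite none.
Qed.

Lemma card_mark_pair M (p q : 'I_N) : p < q -> p \notin M -> q \notin M ->
  #|[set p; q] :|: M| = #|M|.+2.
Proof.
move=> ltpq np nq; rewrite -setUA !cardsU1 !inE (negPf np) (negPf nq).
by rewrite -val_eqE /= (ltn_eqF ltpq).
Qed.

(** The new pair adds a one before its zero. Everything between the two is already marked, so at any
    remaining unmarked coordinate both counts grow equally. *)
Lemma balanced_mark_step M : balanced M -> balanced (mark_step x M).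
Proof.
case: mark_stepP => // p q /and5P[ltpq np nq xp /andP[xq /forallP btw]] [evM leM eqM].
have npq : p \notin q |: M by rewrite !inE -val_eqE /= (ltn_eqF ltpq) (negPf np).
have cnt b u : prefix_count ([set p; q] :|: M) b u =
    ((p < u) && b) + (((q < u) && ~~ b) + prefix_count M b u).
  by rewrite -setUA !prefix_countU1 // xp (negPf xq); case: b.
split=> [|u|i]; rewrite ?card_mark_pair //= ?cnt.
- by rewrite negbK.
- by rewrite ?cnt /= !andbT !andbF; have := leM u; lia.
- rewrite !inE !negb_or -!val_eqE /= => /andP[/andP[neip neiq] ni].
  rewrite ?cnt /= !andbT !andbF (eqM i ni) /= !add0n; congr (_ + _); congr nat_of_bool.
  have := btw i; rewrite (negPf ni) implybF; lia.
Qed.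

Lemma balanced_marked : balanced (marked x).
Proof.
suff iterP j : balanced (iter j (mark_step x) set0) by apply: iterP.
elim: j => [|j IHj] /=; last exact: balanced_mark_step.
have cnt0 b u : prefix_count set0 b u = 0.
  by apply: eq_card0 => i; rewrite !inE.
by split=> [|u|i _]; rewrite ?cards0 ?cnt0.
Qed.

(** A step that does not stop marks two new coordinates, so after [N] steps either the process has
    stopped or everything is marked. *)
Lemma marked_maximal pq : ~~ markable x (marked x) pq.
Proof.
have iterP j : (forall pq, ~~ markable x (iter j (mark_step x) set0) pq)
    \/ j <= #|iter j (mark_step x) set0|.
  elim: j => [|j [none|lej]] /=; first by right.
    by left; case: mark_stepP => // p q; rewrite (negPf (none _)).
  case: mark_stepP => [p q /and5P[ltpq np nq _ _]|]; last by left.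
  by right; rewrite card_mark_pair //; lia.
have [// | leN] := iterP N.
case: pq => p q; apply/negP => /and5P[_ /negP np _ _ _]; case: np.
by have /eqP/setP-> : marked x == setT; rewrite ?inE // eqEcard subsetT cardsT card_ord.
Qed.

(** Induction on [q - p]: an unmarked one before an unmarked zero is markable unless another
    unmarked coordinate lies between, which splits the interval. *)
Lemma unmarked_sorted (p q : 'I_N) :
  p \in unmarked x -> q \in unmarked x -> p < q -> tnth x p -> tnth x q.
Proof.
rewrite !inE; have [m] := ubnP (q - p); elim: m => // m IHm in p q *.
rewrite ltnS => lem np nq ltpq xp.
have [//|nxq] := boolP (tnth x q).
have := marked_maximal (p, q); rewrite /markable ltpq np nq xp nxq /=.
rewrite negb_forall => /existsP[i]; rewrite negb_imply => /andP[/andP[ltpi ltiq] ni].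
have xi : tnth x i by apply: IHm xp => //; lia.
by have := IHm i q _ ni nq ltiq xi; rewrite (negPf nxq); apply; lia.
Qed.

Definition unmarked_zeros := [set i in unmarked x | ~~ tnth x i].

Lemma chain_botE : N = (chain_bot x).*2 + #|unmarked x|.
Proof.
have [ev _ _] := balanced_marked; have := cardsC (marked x).
by rewrite card_ord /chain_bot /unmarked; lia.
Qed.

(** Since the unmarked bits are sorted, an unmarked coordinate carries a one exactly when all the
    unmarked zeros precede it. *)
Lemma chain_elt_zeros :
  chain_elt x (chain_bot x + (#|unmarked x| - #|unmarked_zeros|)) = x.
Proof.
apply: eq_from_tnth => i; rewrite tnth_mktuple; case: ifPn => // ni.
have ui : i \in unmarked x by rewrite inE.
have leZ : #|unmarked_zeros| <= #|unmarked x|.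
  by apply/subset_leq_card/subsetP=> j; rewrite inE => /andP[].
rewrite addKn subKn // /unmarked_before; case: (boolP (tnth x i)) => xi.
  apply/subset_leq_card/subsetP => j; rewrite !inE => /andP[nj xj].
  rewrite nj /=; case: ltngtP => // [ltij|/val_inj eij]; last by rewrite eij xi in xj.
  by rewrite (@unmarked_sorted i j) ?inE in xj.
apply/negbTE; rewrite -ltnNge; apply: proper_card; apply/properP; split.
  apply/subsetP => j; rewrite !inE => /andP[nj ltji]; rewrite nj /=.
  by apply: contra xi; apply: unmarked_sorted; rewrite ?inE.
by exists i; rewrite !inE ?ni ?ltnn ?andbF.
Qed.

Lemma nth_chain t : t <= #|unmarked x| ->
  nth x (chain x) t = chain_elt x (chain_bot x + t).
Proof.
have sz : (N - chain_bot x - chain_bot x).+1 = #|unmarked x|.+1.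
  by rewrite {1}chain_botE; lia.
by move=> let_; rewrite /chain sz (nth_map 0) ?size_iota // nth_iota.
Qed.

Lemma size_chain : size (chain x) = #|unmarked x|.+1.
Proof. by rewrite size_map size_iota {1}chain_botE; lia. Qed.

(** * The first bit of [psi] on inputs starting with 0 *)

Section FirstZero.

Variable i0 : 'I_N.
Hypotheses (i0E : i0 = 0 :> nat) (xi0 : ~~ tnth x i0).

(** If marked, this zero would have no earlier one to balance it in the prefix of length 1. *)
Lemma first_unmarked : i0 \in unmarked x.
Proof.
rewrite inE; apply/negP => i0M; have [_ /(_ 1) + _] := balanced_marked.
rewrite /prefix_count (cardsD1 i0) !inE i0M i0E (negPf xi0) /= ltnNge => /negP[].
rewrite (eq_card0 (A := [set i in _ | _])) // => i; rewrite !inE ltnS leqn0.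
case: eqP => //= [|_]; rewrite ?andbF // -i0E => /val_inj->.
by rewrite (negPf xi0) andbF.
Qed.

(** As [i0] is the leftmost unmarked coordinate, only the top of the chain has a one there; [psi]
    selects the top exactly when [x] is the top or the element just below it. *)
Lemma psi1_chain_index : psi1 x = (#|unmarked x| <= (index x (chain x)).+1).
Proof.
have U_gt0 : 0 < #|unmarked x| by apply/card_gt0P; exists i0; apply: first_unmarked.
have elt0 r : nth false (chain_elt x r) 0 = (chain_bot x + #|unmarked x| <= r).
  rewrite -i0E -tnth_nth tnth_mktuple.
  have := first_unmarked; rewrite inE => /negPf->.
  rewrite /unmarked_before (eq_card0 (A := [set u in _ | _])); first by lia.
  by move=> i; rewrite !inE i0E andbF.
have N_gt0 : 0 < N by rewrite -i0E ltn_ord.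
have rconsE r b : tnth [tuple of rcons (chain_elt x r) b] ord0
    = (chain_bot x + #|unmarked x| <= r).
  rewrite (tnth_nth false) -elt0 [LHS](nth_rcons false (chain_elt x r)).
  by rewrite size_tuple N_gt0.
rewrite /psi1 /psi /chain_index.
have -> : N - chain_bot x = chain_bot x + #|unmarked x| by rewrite {1}chain_botE; lia.
by case: ifP => par; rewrite rconsE; lia.
Qed.

(** [index] finds the first occurrence of [x], known only to be at most [m - z]. An occurrence below
    [m - 1] is excluded without injectivity of the chain: it would put zeros on the two leftmost
    unmarked coordinates. *)
Lemma index_chain :
  (#|unmarked x| <= (index x (chain x)).+1) = (#|unmarked_zeros| <= 1).
Proof.
set m := #|_|; set z := #|_|; apply/idP/idP => [le_idx|lez].
  have := @index_nth _ x (m - z) (chain x); rewrite size_chain nth_chain ?leq_subr //.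
  rewrite chain_elt_zeros -/m ltnS leq_subr => /(_ isT).
  have : z <= m by apply/subset_leq_card/subsetP=> j; rewrite inE => /andP[].
  have : 0 < z by apply/card_gt0P; exists i0; rewrite inE first_unmarked.
  lia.
rewrite leqNgt; apply/negP => lt_idx; set t := index _ _ in lt_idx.
have eltx : chain_elt x (chain_bot x + t) = x.
  rewrite -nth_chain ?nth_index //; last by rewrite -/m; lia.
  by rewrite -index_mem size_chain -/m -/t; lia.
have := cardsD1 i0 (unmarked x); rewrite first_unmarked -/m add1n => cardU.
have /card_gt0P[i1 i1U] : 0 < #|unmarked x :\ i0| by rewrite -ltnS -cardU; lia.
case: (arg_minnP (P := mem (unmarked x :\ i0)) (fun i : 'I_N => nat_of_ord i) i1U) => i.
rewrite /= in_setD1 => /andP[neii0 iU] min_i.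
have xi : tnth x i.
  apply: contraTT lez => xi; rewrite -ltnNge /z (cardsD1 i0) (cardsD1 i).
  by rewrite !inE neii0 xi0 xi -!in_setC iU first_unmarked.
have : unmarked_before x i <= 1.
  rewrite -(cards1 i0); apply/subset_leq_card/subsetP => j.
  rewrite !inE => /andP[nj]; apply: contraTT => nej.
  by rewrite -leqNgt; apply: min_i; rewrite !inE nej.
move: xi; rewrite -{1}eltx tnth_mktuple; move: iU; rewrite inE => /negPf->.
by rewrite -/m; lia.
Qed.

(** In every prefix the marked zeros are outnumbered or matched by marked ones, so any excess comes
    from unmarked zeros. *)
Lemma psi1_prefix :
  psi1 x <->
  forall u, count (pred1 false) (take u x) <= (count (pred1 true) (take u x)).+1.
Proof.
have [_ leM eqM] := balanced_marked.
rewrite psi1_chain_index index_chain; split=> [lez u|pre].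
  rewrite -!prefix_count_setT -!(prefix_countC (marked x)).
  have := leM u; suff : prefix_count (~: marked x) false u <= 1 by lia.
  apply: leq_trans lez; apply/subset_leq_card/subsetP => i.
  by rewrite !inE eqbF_neg => /and3P[-> _ ->].
rewrite leqNgt; apply/negP => z_gt1.
have /card_gt0P[i] : 0 < #|unmarked_zeros :\ i0|.
  by move: z_gt1; rewrite (cardsD1 i0) inE first_unmarked xi0.
rewrite in_setD1 inE => /and3P[neii0 iU nxi].
(* The prefix ending at a second unmarked zero [i] violates the bound: its marked part is balanced,
   and its unmarked part has no ones and at least two zeros. *)
have := pre i.+1; rewrite -!prefix_count_setT -!(prefix_countC (marked x)).
have niM : i \notin marked x by rewrite inE in iU.
have cntM b : prefix_count (marked x) b i.+1 = prefix_count (marked x) b i.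
  apply: eq_card => j; rewrite !inE ltnS; case: ltngtP => // /val_inj->.
  by rewrite (negPf niM).
have -> : prefix_count (~: marked x) true i.+1 = 0.
  apply: eq_card0 => j; rewrite !inE ltnS; apply/negP => /and3P[nj leji /eqP xj].
  move: leji nxi; rewrite leq_eqVlt => /predU1P[/val_inj<-|ltji]; first by rewrite xj.
  by rewrite (@unmarked_sorted j i) ?inE ?xj.
have : 1 < prefix_count (~: marked x) false i.+1.
  rewrite /prefix_count (cardsD1 i0) (cardsD1 i) !inE neii0 niM i0E ltnSn.
  by have := first_unmarked; rewrite inE => ->; rewrite (negPf xi0) (negPf nxi).
rewrite !cntM eqM //; lia.
Qed.

End FirstZero.

End Marking.

(** * The padding map and its prefix counts *)

Definition pad_seq n (x : bits n) : seq bool :=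
  false :: nseq n true ++ x ++ nseq n.+1 false ++ nseq (3 * n) true.

Lemma size_pad n (x : bits n) : size (pad_seq x) == (3 * n + 1).*2.
Proof. by rewrite /= !size_cat !size_nseq size_tuple /= size_cat !size_nseq; lia. Qed.

Definition pad n (x : bits n) : bits (3 * n + 1).*2 := Tuple (size_pad x).

(** Truncated subtraction gives prefix counts of a concatenation as one formula without case
    analysis. *)
Lemma take_cat_sub (T : Type) u (s1 s2 : seq T) :
  take u (s1 ++ s2) = take u s1 ++ take (u - size s1) s2.
Proof.
rewrite take_cat; case: ltnP => [/ltnW|] le_us.
  by rewrite (eqP le_us) take0 cats0.
by rewrite (take_oversize le_us).
Qed.

Lemma count_take_nseq (T : Type) (a : pred T) u m y :
  count a (take u (nseq m y)) = a y * minn u m.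
Proof.
case: leqP => [|/ltnW] le_um; first by rewrite take_nseq // count_nseq.
by rewrite take_oversize ?size_nseq // count_nseq.
Qed.

(** The [n] ones pay for every zero of [x], so the prefix bound can only fail inside the block of
    [n.+1] zeros, where the excess is largest at the end, or after it, where the excess
    decreases. *)
Lemma majority_pad n (x : bits n) : majority x = psi1 (pad x).
Proof.
have i0P : 0 < (3 * n + 1).*2 by lia.
have psiE := @psi1_prefix _ (pad x) (Ordinal i0P) erefl erefl.
have cntx v :
  [/\ count (pred1 true) (take v x) + count (pred1 false) (take v x) = minn v n,
    count (pred1 true) (take v x) <= hweight x
    & n <= v -> count (pred1 true) (take v x) = hweight x].
  have pred1T : count (pred1 true) =1 count id by move=> s; apply: eq_count => -[].
  have -> : count (pred1 false) (take v x) = count (predC id) (take v x).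
    by apply: eq_count => -[].
  rewrite pred1T count_predC size_take_min size_tuple; split=> //.
    by rewrite /hweight -{2}(cat_take_drop v x) count_cat leq_addr.
  by move=> le_nv; rewrite take_oversize ?size_tuple.
have cnt b u : count (pred1 b) (take u.+1 (pad x)) =
    (b == false) + (b == true) * minn u n + count (pred1 b) (take (u - n) x)
    + (b == false) * minn (u - 2 * n) n.+1
    + (b == true) * minn (u - (3 * n).+1) (3 * n).
  have -> : take u.+1 (pad x)
      = false :: take u (nseq n true ++ x ++ nseq n.+1 false ++ nseq (3 * n) true).
    by [].
  rewrite !take_cat_sub [LHS]/(_ + count _ _) !count_cat.
  rewrite !count_take_nseq !size_nseq size_tuple.
  by case: b => /=; rewrite ?mul0n ?mul1n ?addn0 ?add0n; lia.
(* The prefix of length [1 + n + n + n.+1] has [2n + 2 - |x|] zeros and [n + |x|] ones, so the bound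
   there says [n < 2|x|]. *)
rewrite /majority; apply/idP/idP => [maj|/psiE/(_ (3 * n).+2)].
  apply/psiE => -[|u]; first by rewrite take0.
  rewrite !cnt /= !mul0n !mul1n; have [] := cntx (u - n).
  move: (count _ _) (count _ _) (hweight x) maj => a b h maj eab leah eqa.
  by have [/eqa|] := leqP n (u - n); lia.
rewrite !cnt /= !mul0n !mul1n; have [+ _ hw] := cntx ((3 * n).+1 - n).
by rewrite hw; [move: (hweight x) (count _ _) => h a; lia | lia].
Qed.

Lemma majority_reducible_psi1 : NC0_reducible majority even psi1.
Proof.
exists (fun n => (3 * n + 1).*2), pad, 1; split.
- by move=> n; rewrite /even odd_double.
- by exists 8 => n; case: n => [|[|n]] //; rewrite !expnS; nia.
- move=> n i.
  have nth_pad x : tnth (pad x) i = if i < n.+1 then nth false (false :: nseq n true) i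
      else if i - n.+1 < n then nth false x (i - n.+1)
      else nth false (nseq n.+1 false ++ nseq (3 * n) true) (i - n.+1 - n).
    rewrite (tnth_nth false).
    have -> : pad x = (false :: nseq n true)
        ++ x ++ nseq n.+1 false ++ nseq (3 * n) true :> seq bool by [].
    by rewrite nth_cat /= size_nseq nth_cat size_tuple.
  (* For [i <= n] the truncated difference is 0, so a constant bit may land in the first case;
     allowing it one input bit is harmless. *)
  have [lt_in|le_ni] := ltnP (i - n.+1) n.
    exists [set Ordinal lt_in]; rewrite ?cards1 // => x y /(_ _ (set11 _)).
    by rewrite !(tnth_nth false x) !(tnth_nth false y) /= !nth_pad lt_in => ->.
  exists set0; rewrite ?cards0 // => x y _.
  by rewrite !nth_pad !(ltnNge _ n) le_ni.
- exact: majority_pad.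
Qed.

Theorem proposition3p1 :
  NC0_reducible majority even psi1 /\ ~ in_AC0 even psi1.
Proof.
have red := majority_reducible_psi1; split; first exact: red.
exact: majority_reducible_notin_AC0 red.
Qed.
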